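(* Let $X$ be a real or complex infinite-dimensional separable reflexive Banach space with the Kadec-Klee property, and let $\mathcal{B}_1(X)$ be the set of all bounded linear operators $T$ on $X$ with $\|T\|\le 1$. If $T\in\mathcal{B}_1(X)$ is such that $\|T\|=1$ and the linear span of $$\mathcal{N}(T):=\{z\in X\setminus\{0\}:\ \|Tz\|=\|T\|\,\|z\|\}$$ is dense in $X$, then $T$ is a point of continuity of the identity map $(\mathcal{B}_1(X),\mathtt{WOT})\to(\mathcal{B}_1(X),\mathtt{SOT})$.
   Context: $X$ has the Kadec-Klee property if, whenever $(x_n)$ is a sequence in the closed unit ball $B_X$ converging weakly to some $x$ with $\|x\|=1$, one has $\|x_n-x\|\to 0$. $\mathtt{WOT}$ (resp. $\mathtt{SOT}$) is the topology on operators in which $T_i\to T$ iff $T_ix\to Tx$ weakly (resp. in norm) for every $x\in X$. *)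

(* Defs.v *)
From HB Require Import structures.
From mathcomp Require Import all_boot all_order all_algebra.
From mathcomp Require Import complex.
From mathcomp Require Import all_classical all_reals all_analysis.

Set Implicit Arguments.
Unset Strict Implicit.
Unset Printing Implicit Defensive.

Import Order.TTheory GRing.Theory Num.Theory.
Import numFieldNormedType.Exports.

Local Open Scope classical_set_scope.
Local Open Scope ring_scope.

Variant scalars := RealScalars | ComplexScalars.

Definition scalar_field (R : realType) (k : scalars) : numFieldType :=
  match k with
  | RealScalars => R
  | ComplexScalars => R[i]
  end.

Section Defs.
Variable K : numFieldType.

Definition bounded_linear (V W : normedModType K) (f : V -> W) : Prop :=
  linear f /\ exists M : K, forall x : V, `|f x| <= M * `|x|.

(* Norms are K-valued.  For K = R[i] they lie in the real axis, and an upper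
   bound of a nonempty set of reals for the partial order of R[i] is itself
   real, so that this supremum is the usual real one.  It is meaningful for
   bounded linear f only. *)
Definition opnorm (V W : normedModType K) (f : V -> W) : K :=
  supremum 0 [set `|f x| | x in [set x : V | `|x| <= 1]].

Definition lin_span (X : lmodType K) (A : set X) : set X :=
  [set x | exists (n : nat) (c : 'I_n -> K) (v : 'I_n -> X),
     (forall i, A (v i)) /\ x = \sum_(i < n) c i *: v i].

Definition infinite_dimensional (X : lmodType K) : Prop :=
  forall A : set X, finite_set A -> lin_span A <> setT.

Definition separable (X : topologicalType) : Prop :=
  exists D : set X, countable D /\ dense D.

Variable X : normedModType K.

Definition dual_space : set (X -> K^o) := [set f | bounded_linear f].

(* Elements of the bidual are represented by functions on X -> K^o of which
   only the values on the dual matter. *)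
Definition bidual : set ((X -> K^o) -> K) :=
  [set Phi | (forall (a : K) (f g : X -> K^o), dual_space f -> dual_space g ->
                Phi (a *: f + g) = a * Phi f + Phi g) /\
             exists M : K, forall f, dual_space f -> `|Phi f| <= M * opnorm f].

Definition reflexive_space : Prop :=
  forall Phi, bidual Phi -> exists x : X, forall f, dual_space f -> Phi f = f x.

Definition weak_space : topologicalType :=
  initial_topology
    (fun x : X => (fun f : dual_space => val f x) : {ptws dual_space -> K^o}).

Definition kadec_klee : Prop :=
  forall (u : nat -> X) (x : X), (forall n, `|u n| <= 1) -> `|x| = 1 ->
    (u : nat -> weak_space) @ \oo --> (x : weak_space) ->
    (fun n => `|u n - x|) @ \oo --> (0 : K).

Definition unit_ball_op : set (X -> X) :=
  [set T | bounded_linear T /\ opnorm T <= 1].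

Definition WOT : topologicalType :=
  initial_topology (fun T : unit_ball_op => (val T : {ptws X -> weak_space})).

Definition SOT : topologicalType :=
  initial_topology (fun T : unit_ball_op => (val T : {ptws X -> X})).

Definition norm_attaining (T : X -> X) : set X :=
  [set z | z != 0 /\ `|T z| = opnorm T * `|z|].

End Defs.

Arguments dual_space {K} X.
Arguments unit_ball_op {K} X.

(* Main.v *)
Require Import Defs.
From HB Require Import structures.
From mathcomp Require Import all_boot all_order all_algebra.
From mathcomp Require Import complex.
From mathcomp Require Import ring.
From mathcomp Require Import all_classical all_reals all_analysis.
Import Order.TTheory GRing.Theory Num.Theory.
Import numFieldNormedType.Exports.
Local Open Scope classical_set_scope.
Local Open Scope ring_scope.

(** Since every S in the unit ball of operators is a contraction, the set of
    vectors x for which S x tends to T x in norm as S tends to T in WOT is a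
    closed subspace.  It therefore suffices to treat x in [norm_attaining T],
    normalized so that x and y := T x both have norm 1.  Then S x stays in the
    closed unit ball B and tends weakly to y, and what is needed is that the
    weak neighbourhoods of y, traced on B, refine its norm neighbourhoods.

    The Kadec-Klee property says this for sequences only.  To pass to
    neighbourhoods, B must be tested by countably many functionals:
    - the dual separates the points of X.  Here this follows from the
      Kadec-Klee property rather than from the Hahn-Banach theorem: if all
      functionals vanished at a vector y of norm 1, the constant sequence 0
      would converge weakly to y without converging in norm
      ([kadec_klee_dual_separates]);
    - X being separable, a sequence of functionals f_n already separates
      points, by a Lindelof argument on the nonzero vectors
      ([separating_sequence]);
    - by reflexivity, every ultrafilter on B converges weakly
      ([reflexive_ball_weak_limit]).  Hence a sequence of B on which each f_n
      tends to its value at y converges weakly to y: all its ultrafilter limits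
      have the same image as y under every f_n ([ball_weak_cvg]).
    If no neighbourhood defined by finitely many f_n were good enough for a
    given radius, choosing bad points would give a sequence in B converging
    weakly but not in norm to y ([kadec_klee_weak_nbhs]).  As finitely many
    conditions on the f_n (S x) define a WOT neighbourhood of T, this concludes.
*)

Set Implicit Arguments.
Unset Strict Implicit.

(** * Initial, weak and operator topologies *)

Lemma cvg_initial (S : choiceType) (T : topologicalType) (f : S -> T)
    (F : set_system S) (s : S) :
  Filter F -> f @ F --> f s -> F --> (s : initial_topology f).
Proof.
move=> FF fFs A /= [_ [[B Bop <-] Bfs sBfA]].
by apply: filterS sBfA _; apply: fFs; exact: open_nbhs_nbhs.
Qed.

Lemma cvg_ptws (U : Type) (V : topologicalType)
    (F : set_system (U -> V)) (f : U -> V) :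
  Filter F -> (forall t, (fun g => g t) @ F --> f t) ->
  F --> (f : {ptws U -> V}).
Proof. by move=> FF Ff; apply/cvg_sup => t; apply: cvg_initial; exact: Ff. Qed.

Lemma weak_cvg (K : numFieldType) (X : normedModType K)
    (F : set_system X) (x : X) :
  Filter F -> (forall f : X -> K^o, dual_space X f -> f @ F --> f x) ->
  F --> (x : weak_space X).
Proof.
move=> FF Ff; apply: cvg_initial; apply: cvg_ptws => f.
by apply: (Ff (val f)); exact: set_valP.
Qed.

Lemma weak_continuous (K : numFieldType) (X : normedModType K) (f : X -> K^o) :
  dual_space X f -> continuous (f : weak_space X -> K^o).
Proof.
move=> /mem_set Xf x.
pose ev (y : weak_space X) : {ptws dual_space X -> K^o} := fun g => val g y.
pose at_f (g : {ptws dual_space X -> K^o}) : K^o := g (SigSub Xf).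
have evc : {for x, continuous ev} by exact: initial_continuous.
have at_fc : {for ev x, continuous at_f}.
  exact: (@proj_continuous (dual_space X) (fun=> K^o) (SigSub Xf)).
exact: (continuous_comp evc at_fc).
Qed.

Lemma WOT_continuous (K : numFieldType) (X : normedModType K)
    (f : X -> K^o) (x : X) :
  dual_space X f -> continuous (fun S : WOT X => f (val S x) : K^o).
Proof.
move=> Xf S.
pose op (S' : WOT X) : {ptws X -> weak_space X} := val S'.
pose at_x (g : {ptws X -> weak_space X}) : weak_space X := g x.
have opc : {for S, continuous op} by exact: initial_continuous.
have at_xc : {for op S, continuous at_x}.
  exact: (@proj_continuous X (fun=> weak_space X) x).
have fc : {for at_x (op S), continuous (f : weak_space X -> K^o)}.
  exact: weak_continuous.
exact: (continuous_comp (continuous_comp opc at_xc) fc).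
Qed.

Lemma cvg_SOT (K : numFieldType) (X : normedModType K)
    (F : set_system (unit_ball_op X)) (T : unit_ball_op X) :
  Filter F -> (forall x, val S x @[S --> F] --> val T x) -> F --> (T : SOT X).
Proof.
by move=> FF Fx; apply: cvg_initial; apply: cvg_ptws => x; exact: Fx.
Qed.

(** Otherwise some neighbourhood A of l has a preimage outside F, so F remains
    proper when restricted to the complement of this preimage, and an
    ultrafilter finer than this restriction contradicts the hypothesis. *)
Lemma cvg_ultra (T : Type) (U : topologicalType) (F : set_system T) (g : T -> U)
    (l : U) : Filter F ->
  (forall G, UltraFilter G -> F `<=` G -> g @ G --> l) -> g @ F --> l.
Proof.
move=> FF Gl A lA; apply: contrapT => nFA.
pose H := within (~` (g @^-1` A)) F.
have HH : ProperFilter H.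
  apply: Build_ProperFilter_ex => B HB; apply: contrapT => nB; apply: nFA.
  have FB : F [set t | ~ A (g t) -> B t] := HB.
  apply: (@filterS _ F _ _ (g @^-1` A) _ FB) => t Bt; apply: contrapT => nAt.
  by apply: nB; exists t; exact: Bt.
have [G [GU HG]] := ultraFilterLemma HH.
have GA : G (g @^-1` A).
  apply: Gl lA => B FB; apply: HG; apply: filterS FB => t Bt _; exact: Bt.
have GnA : G (~` (g @^-1` A)) by apply: HG; exact: withinT.
by have [t []] := filter_ex (filterI GA GnA).
Qed.

(** * Real and complex scalars *)

Lemma gt0_complexE (R : realType) (e : R[i]) : 0 < e ->
  exists2 r : R, e = r%:C%C & 0 < r.
Proof.
by case: e => r s; rewrite ltcE /= => /andP[/eqP-> r0]; exists r.
Qed.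

Lemma scalar_archimedean (R : realType) (k : scalars) (e : scalar_field R k) :
  0 < e -> exists n : nat, n.+1%:R^-1 < e.
Proof.
case: k e => /= e e0.
  by have [n] := ltr_add_invr e0; rewrite add0r; exists n.
have [r -> r0] := gt0_complexE e0.
have [n] := ltr_add_invr r0; rewrite add0r => nr; exists n.
by rewrite -(rmorph_nat (real_complex R)) -fmorphV ltcR.
Qed.

(** The norms of a complex space are complex numbers with zero imaginary part.
    An upper bound of a nonempty set of such numbers is itself real, so the
    real supremum of the real parts is the least upper bound for the partial
    order of R[i]; this is what gives [opnorm] its meaning. *)
Lemma scalar_supremums (R : realType) (k : scalars)
    (A : set (scalar_field R k)) (M : scalar_field R k) :
  A !=set0 -> (forall a, A a -> 0 <= a) -> ubound A M -> supremums A !=set0.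
Proof.
case: k A M => /= A M [a Aa] A0 AM.
  have supA : has_sup A by split; [exists a|exists M].
  exists (reals.sup A); split; first exact: sup_upper_bound.
  by move=> u Au; apply: ge_sup => //; exists a.
have ReA z : A z -> z = (complex.Re z)%:C%C.
  by move/A0; case: z => x y; rewrite lecE /= => /andP[/eqP->].
have supA : has_sup (@complex.Re R @` A).
  split; first by exists (complex.Re a), a.
  exists (complex.Re M) => _ [z Az <-].
  by have := AM _ Az; rewrite lecE => /andP[].
exists (reals.sup (@complex.Re R @` A))%:C%C; split.
  move=> z Az; rewrite (ReA z Az) lecR; exact: sup_upper_bound.
move=> u Au; rewrite lecE /=; apply/andP; split.
  by have := Au _ Aa; rewrite lecE (ReA a Aa) => /andP[].
apply: ge_sup; first by exists (complex.Re a), a.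
by move=> _ [z Az <-]; have := Au _ Az; rewrite lecE => /andP[].
Qed.

(** The limit is the supremum of the r such that r <= g t holds along the
    ultrafilter. *)
Lemma ultra_cvg_real (R : realType) (T : Type) (F : set_system T) (g : T -> R)
    (M : R) : UltraFilter F -> (\forall t \near F, `|g t| <= M) ->
  exists l : R, forall e, 0 < e -> \forall t \near F, `|g t - l| < e.
Proof.
move=> FU gM.
pose A := [set r | \forall t \near F, r <= g t].
have supA : has_sup A.
  split.
    by exists (- M); apply: filterS gM => t; rewrite ler_norml => /andP[].
  exists M => r Ar; have [t []] := filter_ex (filterI gM Ar).
  by move=> gtM rgt; rewrite (le_trans rgt)// (le_trans (ler_norm _)).
exists (reals.sup A) => e e0.
have [r Ar ler] := sup_adherent e0 supA.
have : \forall t \near F, g t < reals.sup A + e.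
  have [//|ge] := in_ultra_setVsetC [set t | g t < reals.sup A + e] FU.
  have /(sup_upper_bound supA) : A (reals.sup A + e).
    by apply: filterS ge => t /= /negP; rewrite -leNgt.
  by rewrite gerDl leNgt e0.
apply: filterS2 Ar => t rgt gtl.
by rewrite ltr_distl (lt_le_trans ler rgt).
Qed.

Lemma ultra_cvg_scalar (R : realType) (k : scalars) (T : Type)
    (F : set_system T) (g : T -> (scalar_field R k)^o) (M : scalar_field R k) :
  UltraFilter F -> (\forall t \near F, `|g t| <= M) ->
  exists l : (scalar_field R k)^o, g @ F --> l.
Proof.
move=> FU gM; suff [l lP] : exists l : scalar_field R k,
    forall e, 0 < e -> \forall t \near F, `|(g t : scalar_field R k) - l| < e.
  by exists l; apply/cvgrPdistC_lt.
case: k g M gM => /= g M gM; first exact: ultra_cvg_real gM.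
have [t0 gt0M] := filter_ex gM.
have ReM z : `|z : R[i]| <= M ->
    Num.sqrt (complex.Re z ^+ 2 + complex.Im z ^+ 2) <= complex.Re M.
  by rewrite normc_def lecE /= => /andP[].
have [|lr lrP] :=
    @ultra_cvg_real R T F (fun t => complex.Re (g t)) (complex.Re M).
  apply: filterS gM => t /ReM; apply: le_trans.
  by rewrite -sqrtr_sqr ler_wsqrtr// lerDl sqr_ge0.
have [|li liP] :=
    @ultra_cvg_real R T F (fun t => complex.Im (g t)) (complex.Re M).
  apply: filterS gM => t /ReM; apply: le_trans.
  by rewrite -sqrtr_sqr ler_wsqrtr// lerDr sqr_ge0.
exists (lr +i* li)%C => e /gt0_complexE[r -> r0].
have r20 : 0 < r / 2 by rewrite divr_gt0.
apply: filterS2 (lrP _ r20) (liP _ r20) => t.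
case: (g t) => x y /= xr yr.
have -> : ((x +i* y) - (lr +i* li) = (x - lr)%:C + (0 +i* (y - li)))%C by simpc.
rewrite (le_lt_trans (ler_normD _ _))//.
rewrite !normc_def /= !expr0n /= addr0 add0r !sqrtr_sqr.
by rewrite -rmorphD /= ltcR [ltRHS](splitr r) ltrD.
Qed.

(** * Bounded linear maps and contractions *)

(** Gives access to the library of linear maps from the predicate [linear]. *)
Lemma bounded_linear_lin (K : numFieldType) (V W : normedModType K)
    (f : V -> W) :
  bounded_linear f -> exists L : {linear V -> W}, f = L.
Proof.
move=> [lin_f _].
by exists (HB.pack_for {linear V -> W} f
  (GRing.isLinear.Build _ _ _ _ f lin_f)).
Qed.

(** A bound of a linear map on the zero space need not be nonnegative, nor
    even real; its absolute value is then a bound as well. *)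
Lemma bounded_linear_ge0 (K : numFieldType) (V W : normedModType K)
    (f : V -> W) :
  bounded_linear f -> exists2 M : K, 0 <= M & forall x, `|f x| <= M * `|x|.
Proof.
move=> [_ [M fM]]; exists `|M| => // x.
rewrite -[X in _ * X]normr_id -normrM ger0_norm ?fM//.
exact: le_trans (fM x).
Qed.

Lemma bounded_linear_continuous (K : numFieldType) (V W : normedModType K)
    (f : V -> W) : bounded_linear f -> continuous f.
Proof.
move=> bf x; have [M M0 fM] := bounded_linear_ge0 bf.
have [L fL] := bounded_linear_lin bf.
apply/cvgrPdistC_lt => e e0.
have M1 : 0 < M + 1 by rewrite ltr_wpDl.
have near_x : \forall z \near nbhs x, `|z - x| < e / (M + 1).
  exact: (@cvgr_distC_lt _ _ _ (nbhs x) _ id x cvg_id _ (divr_gt0 e0 M1)).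
apply: filterS near_x => z; rewrite ltr_pdivlMr// mulrC => ze.
have -> : f z - f x = f (z - x) by rewrite fL linearB.
apply: le_lt_trans ze; apply: le_trans (fM _) _.
by rewrite ler_wpM2r// lerDl.
Qed.

Lemma le_opnorm (R : realType) (k : scalars)
    (V W : normedModType (scalar_field R k)) (f : V -> W) (x : V) :
  bounded_linear f -> `|x| <= 1 -> `|f x| <= opnorm f.
Proof.
move=> bf x1; have [M M0 fM] := bounded_linear_ge0 bf.
set A := [set `|f x| | x in [set x : V | `|x| <= 1]].
have Afx : A `|f x| by exists x.
rewrite /opnorm /supremum -/A ifF; last by apply/eqP => A0; rewrite A0 in Afx.
have [s sA] : supremums A !=set0.
  apply: (@scalar_supremums R k _ M).
  - by exists `|f x|.
  - by move=> _ [y _ <-].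
  - by move=> _ [y /= y1 <-]; apply: le_trans (fM y) _; rewrite ler_piMr.
by case: (xgetPex 0 (ex_intro _ s sA)) => + _; exact.
Qed.

Lemma unit_ball_op_le (R : realType) (k : scalars)
    (X : normedModType (scalar_field R k)) (S : unit_ball_op X) (x : X) :
  `|val S x| <= `|x|.
Proof.
have [bS S1] : bounded_linear (val S) /\ opnorm (val S) <= 1 := set_valP S.
have [L SL] := bounded_linear_lin bS.
have [->|x0] := eqVneq x 0; first by rewrite SL linear0 !normr0.
have nx0 : 0 < `|x| by rewrite normr_gt0.
have := le_trans (@le_opnorm R k _ _ _ (`|x|^-1 *: x) bS _) S1.
rewrite SL linearZ /= !normrZ normfV normr_id.
by rewrite mulVf ?gt_eqF// lexx ler_pdivrMl// mulr1; apply.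
Qed.

(** * Weak compactness of the unit ball and separating functionals *)

(** Along an ultrafilter on the unit ball every functional f has a limit, and
    the map sending f to this limit belongs to the bidual, with norm at most 1.
    Reflexivity represents it by a vector, which is the weak limit. *)
Lemma reflexive_ball_weak_limit (R : realType) (k : scalars)
    (X : normedModType (scalar_field R k)) (F : set_system X) :
  reflexive_space X -> UltraFilter F -> F [set z | `|z| <= 1] ->
  exists x : X,
    forall f : X -> (scalar_field R k)^o, dual_space X f -> f @ F --> f x.
Proof.
move=> reflX FU FB.
have FBf (f : X -> (scalar_field R k)^o) : dual_space X f ->
    F [set z | `|f z| <= opnorm f].
  by move=> Xf; apply: filterS FB => z; exact: le_opnorm.
have /choice[Phi PhiP] : forall f : X -> (scalar_field R k)^o,
    exists l : scalar_field R k,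
      dual_space X f -> f @ F --> (l : (scalar_field R k)^o).
  move=> f; have [Xf|nXf] := pselect (dual_space X f); last by exists 0.
  by have [l fl] := ultra_cvg_scalar FU (FBf f Xf); exists l.
have [|x xP] := reflX Phi; last by exists x => f Xf; rewrite -xP//; exact: PhiP.
split.
  move=> a f g Xf Xg.
  have Xh : dual_space X (a *: f + g).
    have [L fL] := bounded_linear_lin Xf; have [L' gL] := bounded_linear_lin Xg.
    have [M M0 fM] := bounded_linear_ge0 Xf.
    have [M' M'0 gM] := bounded_linear_ge0 Xg.
    split.
      by move=> b u v; rewrite !fctE fL gL !linearP /= addrACA !scalerA mulrC.
    exists (`|a| * M + M') => u; rewrite !fctE.
    rewrite (le_trans (ler_normD _ _))// normrZ mulrDl -mulrA lerD//.
    by rewrite ler_wpM2l.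
  apply: (@norm_cvg_unique _ (scalar_field R k)^o ((a *: f + g) @ F)).
    exact: PhiP.
  by apply: cvgD; [apply: cvgZl_tmp|]; exact: PhiP.
exists 1 => f Xf; rewrite mul1r; apply/ler_addgt0Pr => e e0.
have fPhi : \forall z \near F, `|Phi f - f z| < e.
  exact: (@cvgr_dist_lt _ _ _ F _ f _ (PhiP f Xf) _ e0).
have [z [/= fz fze]] := filter_ex (filterI (FBf f Xf) fPhi).
rewrite -[Phi f](subrK (f z)) (le_trans (ler_normD _ _))// addrC lerD//.
exact: ltW.
Qed.

(** If every functional vanished at x, the constant sequence 0 would converge
    weakly to the normalization of x, and the Kadec-Klee property would force
    its norm 1 to be 0. *)
Lemma kadec_klee_dual_separates (K : numFieldType) (X : normedModType K)
    (x : X) :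
  kadec_klee X -> x != 0 -> exists2 f : X -> K^o, dual_space X f & f x != 0.
Proof.
move=> XKK x0; apply: contrapT => nf.
have fx0 (f : X -> K^o) : dual_space X f -> f x = 0.
  move=> Xf; apply/eqP; apply: contrapT => fx; apply: nf.
  by exists f => //; exact/negP.
pose y := `|x|^-1 *: x.
have y1 : `|y| = 1 by rewrite normrZ normfV normr_id mulVf// normr_eq0.
have : (fun n : nat => `|(0 : X) - y|) @ \oo --> (0 : K).
  apply: (XKK (fun=> 0) y) => //; first by move=> n; rewrite normr0 ler01.
  apply: weak_cvg => f Xf; have [L fL] := bounded_linear_lin Xf.
  have -> : f y = f 0.
    by rewrite fL linear0 /y linearZ /= -fL (fx0 f)// ?scaler0 ?mulr0.
  exact: cvg_cst.
rewrite sub0r normrN y1 => /(norm_cvg_unique (cvg_cst (1 : K)))/eqP.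
by rewrite oner_eq0.
Qed.

(** Lindelof argument: among the balls with centre in a countable dense set
    and radius 1 / (m + 1), those on which some functional has no zero cover the
    nonzero vectors, and one such functional is chosen for each of them. *)
Lemma separating_sequence (R : realType) (k : scalars)
    (X : normedModType (scalar_field R k)) :
  separable X ->
  (forall x : X, x != 0 ->
     exists2 f : X -> (scalar_field R k)^o, dual_space X f & f x != 0) ->
  exists2 f : nat -> X -> (scalar_field R k)^o,
    forall n, dual_space X (f n) & forall x, (forall n, f n x = 0) -> x = 0.
Proof.
move=> [D [Dcount Ddense]] sepX.
have [d dP] : exists d : nat -> X, D `<=` range d.
  have [D0|[d]] := pfcard_geP Dcount; last by exists d => x /(@surj _ _ _ _ d).
  by exists (fun=> 0); rewrite D0.
pose nonvanishing (p : nat * nat) (f : X -> (scalar_field R k)^o) :=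
  forall z, `|z - d p.1| < p.2.+1%:R^-1 -> f z != 0.
have X0 : dual_space X (fun=> 0 : (scalar_field R k)^o).
  split; first by move=> a u v; rewrite scaler0 addr0.
  by exists 0 => u; rewrite normr0 mul0r.
have /choice[h hP] : forall p, exists f : X -> (scalar_field R k)^o,
    dual_space X f /\
    ((exists2 g, dual_space X g & nonvanishing p g) -> nonvanishing p f).
  move=> p; have [[g Xg gp]|ng] :=
    pselect (exists2 g, dual_space X g & nonvanishing p g); first by exists g.
  by exists (fun=> 0).
(* Pairs (index of a centre, index of a radius) are enumerated by nat. *)
exists (fun n => h (odflt (0, 0)%N (unpickle n))) => [n|x hx0].
  exact: (hP _).1.
apply/eqP; apply: contrapT => /negP x0.
have [f Xf fx0] := sepX _ x0.
have fx_gt0 : 0 < `|f x| by rewrite normr_gt0.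
have near_x : \forall z \near nbhs x, `|f z - f x| < `|f x|.
  have fc := @bounded_linear_continuous _ _ _ f Xf x.
  exact: (@cvgr_distC_lt _ _ _ _ _ f _ fc _ fx_gt0).
have [e /= e0 eP] := (nbhs_normP _ _).1 near_x.
(* With radius below e / 2 and centre within this radius of x, the ball lies
   in the ball of radius e around x, where f has no zero. *)
have [n ne] : exists n : nat, n.+1%:R^-1 < e / 2.
  by apply: scalar_archimedean; rewrite divr_gt0.
have [|y [xy Dy]] := Ddense (ball x n.+1%:R^-1) _ (ball_open x _).
  by exists x; apply: ballxx; rewrite invr_gt0.
have [i _ diy] := dP _ Dy.
have := hx0 (pickle (i, n)); rewrite pickleK /=; apply/eqP.
apply: (hP (i, n)).2 => /=; last by rewrite diy; rewrite -ball_normE in xy.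
exists f => // z; rewrite /= diy => zy.
apply/negP => /eqP fz0; have /eP : ball_ Num.norm x e z.
  rewrite /ball_ /= [e]splitr -(subrK y x) -addrA.
  rewrite (le_lt_trans (ler_normD _ _))//.
  rewrite ltrD ?(lt_trans _ ne)//; first by rewrite -ball_normE in xy.
  by rewrite distrC.
by rewrite /= fz0 sub0r normrN ltxx.
Qed.

(** On the unit ball of a reflexive space, weak convergence can be tested on
    any separating family of functionals: each ultrafilter finer than the
    sequence has a weak limit, and the family identifies it with y. *)
Lemma ball_weak_cvg (R : realType) (k : scalars)
    (X : normedModType (scalar_field R k))
    (f : nat -> X -> (scalar_field R k)^o) (u : nat -> X) (y : X) :
  reflexive_space X -> (forall n, dual_space X (f n)) ->
  (forall x, (forall n, f n x = 0) -> x = 0) ->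
  (forall n, `|u n| <= 1) -> (forall i, f i \o u @ \oo --> f i y) ->
  (u : nat -> weak_space X) @ \oo --> (y : weak_space X).
Proof.
move=> reflX Xf fsep u1 fu; apply: weak_cvg => g Xg.
apply: cvg_ultra => G GU uG.
have GB : G [set z | `|z| <= 1] by apply: uG; exact: (@filterE _ \oo).
have [x xP] := reflexive_ball_weak_limit reflX GU GB.
suff -> : y = x by exact: xP.
apply/eqP; rewrite -subr_eq0; apply/eqP; apply: fsep => i.
have [L fL] := bounded_linear_lin (Xf i); rewrite fL linearB -fL.
apply/eqP; rewrite subr_eq0; apply/eqP.
apply: (@norm_cvg_unique _ (scalar_field R k)^o (f i @ G)); last exact: xP.
by move=> A /fu; exact: uG.
Qed.

(** * From sequences to neighbourhoods *)

(** Countably many test functionals suffice, so that the failure of the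
    conclusion for every n produces a sequence of the unit ball converging
    weakly to y and staying at distance e from it, against Kadec-Klee. *)
Lemma kadec_klee_weak_nbhs (R : realType) (k : scalars)
    (X : normedModType (scalar_field R k))
    (f : nat -> X -> (scalar_field R k)^o) (y : X) (e : scalar_field R k) :
  kadec_klee X ->
  reflexive_space X -> (forall n, dual_space X (f n)) ->
  (forall x, (forall n, f n x = 0) -> x = 0) ->
  `|y| = 1 -> 0 < e ->
  exists n : nat, forall z, `|z| <= 1 ->
    (forall i, (i < n)%N -> `|f i z - f i y| < n.+1%:R^-1) -> `|z - y| < e.
Proof.
move=> XKK reflX Xf fsep y1 e0; apply: contrapT => nex.
have /choice[u uP] : forall n : nat, exists z, [/\ `|z| <= 1,
    forall i, (i < n)%N -> `|f i z - f i y| < n.+1%:R^-1 & ~ `|z - y| < e].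
  move=> n; apply: contrapT => nz; apply: nex; exists n => z z1 fz.
  by apply: contrapT => zy; apply: nz; exists z.
have u1 n : `|u n| <= 1 by case: (uP n).
have uy : (fun n => `|u n - y|) @ \oo --> (0 : (scalar_field R k)^o).
  apply: XKK => //; apply: (@ball_weak_cvg R k X f) => // i.
  apply/cvgrPdistC_lt => d d0; have [m md] := scalar_archimedean d0.
  near=> n; have [_ fu _] := uP n; apply: lt_trans (fu i _) _.
    by near: n; exact: nbhs_infty_gt.
  apply: le_lt_trans md; rewrite lef_pV2 ?posrE// ler_nat ltnS.
  by near: n; exact: nbhs_infty_ge.
have [n] := filter_ex ((cvgr0Pnorm_lt _).1 uy e e0); rewrite normr_id.
by case: (uP n).
Unshelve. all: by end_near. Qed.

(** After normalization, a norm-attaining z gives a unit vector x whose image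
    T x is again a unit vector, so that the Kadec-Klee property applies at
    T x to the points S x of the unit ball.  WOT convergence is spelled out
    for a filter F. *)
Lemma norm_attaining_cvg (R : realType) (k : scalars)
    (X : normedModType (scalar_field R k)) (F : set_system (unit_ball_op X))
    (T : unit_ball_op X) (z : X) :
  Filter F ->
  (forall (f : X -> (scalar_field R k)^o) x, dual_space X f ->
     f (val S x) @[S --> F] --> f (val T x)) ->
  separable X -> reflexive_space X -> kadec_klee X ->
  opnorm (val T) = 1 -> norm_attaining (val T) z ->
  val S z @[S --> F] --> val T z.
Proof.
move=> FF FT sepX reflX XKK T1 [z0]; rewrite T1 mul1r => Tz.
have nz0 : 0 < `|z| by rewrite normr_gt0.
have [f Xf fsep] := separating_sequence sepX
  (fun x => @kadec_klee_dual_separates _ X x XKK).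
pose x := `|z|^-1 *: z.
have x1 : `|x| = 1 by rewrite normrZ normfV normr_id mulVf// gt_eqF.
have lin_z (S : unit_ball_op X) : val S z = `|z| *: val S x.
  have [bS _] : bounded_linear (val S) /\ _ := set_valP S.
  have [L ->] := bounded_linear_lin bS.
  by rewrite /x linearZ /= scalerA mulfV ?scale1r// gt_eqF.
have Tx1 : `|val T x| = 1.
  apply: (mulfI (lt0r_neq0 nz0)).
  by rewrite mulr1 -[RHS]Tz lin_z normrZ normr_id.
apply/cvgrPdistC_lt => e e0.
have [n nP] := kadec_klee_weak_nbhs XKK reflX Xf fsep Tx1
  (divr_gt0 e0 nz0).
have near_f (i : nat) : \forall S \near F,
    `|f i (val S x) - f i (val T x)| < n.+1%:R^-1.
  apply: (cvgrPdistC_lt (fun S : unit_ball_op X => f i (val S x)) _).1.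
    exact: FT.
  by rewrite invr_gt0.
have near_all : \forall S \near F, forall i : 'I_n,
    `|f i (val S x) - f i (val T x)| < n.+1%:R^-1.
  by apply: filter_forall => i; exact: near_f.
apply: filterS near_all => S fS.
rewrite !lin_z -scalerBr normrZ normr_id mulrC -ltr_pdivlMr//.
apply: nP; first by rewrite (le_trans (unit_ball_op_le _ _))// x1.
by move=> i ilt; exact: (fS (Ordinal ilt)).
Qed.

Theorem proposition2p14 (R : realType) (k : scalars)
    (X : completeNormedModType (scalar_field R k))
    (Xinf : infinite_dimensional X) (Xsep : separable X)
    (Xrefl : reflexive_space X) (XKK : kadec_klee X)
    (T : unit_ball_op X) (T1 : opnorm (val T) = 1)
    (Tdense : dense (lin_span (norm_attaining (val T)))) :
  {for T, continuous (id : WOT X -> SOT X)}.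
Proof.
suff SOT_cvg F : Filter F ->
    (forall (f : X -> (scalar_field R k)^o) x, dual_space X f ->
       f (val S x) @[S --> F] --> f (val T x)) -> F --> (T : SOT X).
  have WOT_SOT : nbhs (T : WOT X) --> (T : SOT X).
    apply: SOT_cvg => f x Xf; exact: (@WOT_continuous _ X f x Xf T).
  exact: WOT_SOT.
move=> FF FT; apply: cvg_SOT => x; apply/cvgrPdistC_lt => e e0.
have e30 : 0 < e / 3 by rewrite divr_gt0.
have linS (S : unit_ball_op X) : exists L : {linear X -> X}, val S = L.
  have [bS _] : bounded_linear (val S) /\ _ := set_valP S.
  exact: bounded_linear_lin.
(* e / 3: the approximation of x by y costs one third for S, one for T. *)
have [|y [xy [n [c [v [vT yE]]]]]] := Tdense (ball x (e / 3)) _ (ball_open x _).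
  by exists x; exact: ballxx.
have Ty : val S y @[S --> F] --> val T y.
  have sumE (S : unit_ball_op X) : val S y = \sum_(i < n) c i *: val S (v i).
    have [L ->] := linS S.
    by rewrite yE linear_sum; apply: eq_bigr => i _; rewrite linearZ.
  rewrite (funext sumE) sumE.
  apply: cvg_big => [|i _]; first exact: add_continuous.
  by apply: cvgZl_tmp; exact: norm_attaining_cvg.
have near_y : \forall S \near F, `|val S y - val T y| < e / 3.
  exact: (cvgrPdistC_lt (fun S : unit_ball_op X => val S y) _).1.
apply: filterS near_y => S Sy.
have xye : `|x - y| < e / 3 by rewrite -ball_normE in xy.
have SB (S' : unit_ball_op X) u w : `|val S' u - val S' w| <= `|u - w|.
  by have [L SL] := linS S'; rewrite SL -linearB -SL unit_ball_op_le.
have -> : e = e / 3 + e / 3 + e / 3 by field.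
rewrite -[val S x](subrK (val S y)) -addrA (le_lt_trans (ler_normD _ _))//.
rewrite -addrA ltrD// ?(le_lt_trans (SB _ _ _))//.
rewrite -[val S y](subrK (val T y)) -addrA (le_lt_trans (ler_normD _ _))//.
by rewrite ltrD// (le_lt_trans (SB _ _ _))// distrC.
Qed.
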